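(* Let $A\in\mathbb{R}^{n\times n}$, $b_1,\dots,b_m\in\mathbb{R}^n$, and $T>0$. Let $S=\{i_1,\dots,i_k\}\subseteq\{1,\dots,m\}$ be a set of $k=|S|\ge2$ indices with a fixed ordering, let $C_S:=\{p\in\Delta_m\mid p_i=0\text{ for every }i\notin S\}$ and $\mathcal L_{C_S}:=\operatorname{lin}(C_S-C_S)$. Let $E_S:=[\,e^{(m)}_{i_1}\ \cdots\ e^{(m)}_{i_k}\,]\in\mathbb{R}^{m\times k}$, let $Z_S\in\mathbb{R}^{k\times(k-1)}$ have columns forming an orthonormal basis of $\{z\in\mathbb{R}^k\mid \mathbf 1^\top z=0\}$, and let $M_S:=[\,\operatorname{vec}(W_{i_1}(T))\ \cdots\ \operatorname{vec}(W_{i_k}(T))\,]\in\mathbb{R}^{n^2\times k}$. Then: 1. For every $y\in\mathbb{R}^{k-1}$, $\|\Phi_T(E_SZ_Sy)\|_{\rm F}=\|M_SZ_Sy\|$. 2. The map $\Phi_T$ is injective on $\mathcal L_{C_S}$ if and only if $M_SZ_S$ has full column rank; equivalently, $\sigma_{\min}(M_SZ_S)>0$. 3. The constant $\kappa_{C_S,T}:=\min_{v\in\mathcal L_{C_S},\ \|v\|=1}\|\Phi_T(v)\|_{\rm F}$ satisfies $\kappa_{C_S,T}=\sigma_{\min}(M_SZ_S)$. 4. The constant $\beta_T:=\max_{p\in C_S}\lambda_{\max}(W(p,T))$ satisfies $\beta_T=\max_{i\in S}\lambda_{\max}(W_i(T))$.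
   Context: $\Delta_m:=\{p\in\mathbb{R}^m\mid p_i\ge0,\ \sum_{i=1}^m p_i=1\}$; $W_i(T):=\int_0^T e^{At}b_ib_i^\top e^{A^\top t}\,dt$; $\Phi_T:\mathbb{R}^m\to\mathbb{S}^n$ (real symmetric $n\times n$ matrices) is the linear map $\Phi_T(v):=\sum_{i=1}^m v_iW_i(T)$, and $W(p,T):=\Phi_T(p)$. $e^{(m)}_i$ is the $i$th standard basis vector of $\mathbb{R}^m$; $\mathbf 1$ is the all-ones vector; $\operatorname{vec}$ is column-wise vectorization; $\|\cdot\|$ is the Euclidean norm, $\|\cdot\|_{\rm F}$ the Frobenius norm, $\lambda_{\max}$ the largest eigenvalue; $C_S-C_S=\{p-q\mid p,q\in C_S\}$; $\operatorname{lin}$ is linear span. For a matrix $X\in\mathbb{R}^{a\times b}$, $\sigma_{\min}(X)$ is its smallest singular value, understood as $\sigma_{\min}(X)=\sqrt{\lambda_{\min}(X^\top X)}=\min_{\|y\|=1}\|Xy\|$ (so it is $0$ if $b>a$). *)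

(* Defs.v *)
From HB Require Import structures.
From mathcomp Require Export all_boot all_order all_algebra.
From mathcomp Require Export all_classical all_reals all_analysis.

Set Implicit Arguments.
Unset Strict Implicit.
Unset Printing Implicit Defensive.

Import Order.TTheory GRing.Theory Num.Theory.
Import numFieldNormedType.Exports.
Local Open Scope classical_set_scope.
Local Open Scope ring_scope.

Definition is_minimum (R : realType) (E : set R) (x : R) : Prop :=
  E x /\ lbound E x.

Definition is_maximum (R : realType) (E : set R) (x : R) : Prop :=
  E x /\ ubound E x.

(* The norm that the library puts on matrices is the sup norm, hence the two
   definitions below. *)
Definition norm2 (R : realType) (d : nat) (x : 'cV[R]_d) : R :=
  Num.sqrt (\sum_(i < d) x i 0 ^+ 2).

Definition normF (R : realType) (a c : nat) (X : 'M[R]_(a, c)) : R :=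
  Num.sqrt (\sum_(i < a) \sum_(j < c) X i j ^+ 2).

(* [mxvec] is row-major, so the columns of X are stacked by transposing first. *)
Definition vec (R : realType) (a c : nat) (X : 'M[R]_(a, c)) : 'cV[R]_(c * a) :=
  (mxvec X^T)^T.

(* For a symmetric matrix of positive size the set of real eigenvalues is finite
   and nonempty, so that the sup and the inf are the largest and the smallest
   eigenvalue. *)
Definition lambda_max (R : realType) (d : nat) (X : 'M[R]_d) : R :=
  sup [set a | eigenvalue X a].

Definition lambda_min (R : realType) (d : nat) (X : 'M[R]_d) : R :=
  inf [set a | eigenvalue X a].

Definition sigma_min (R : realType) (a c : nat) (X : 'M[R]_(a, c)) : R :=
  Num.sqrt (lambda_min (X^T *m X)).

Definition lin (R : realType) (V : lmodType R) (E : set V) : set V :=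
  [set v | exists (N : nat) (a : 'I_N -> R) (u : 'I_N -> V),
      (forall j, E (u j)) /\ v = \sum_(j < N) a j *: u j].

Definition difference_set (R : realType) (V : lmodType R) (E : set V) : set V :=
  [set v | exists p q, [/\ E p, E q & v = p - q]].

Definition orthonormal_basis_columns (R : realType) (d r : nat)
    (Z : 'M[R]_(d, r)) (V : set 'cV[R]_d) : Prop :=
  Z^T *m Z = 1%:M /\ [set Z *m y | y in [set: 'cV[R]_r]] = V.

(* The exponential series, summed entry by entry. *)
Definition expmx (R : realType) (n : nat) (A : 'M[R]_n) : 'M[R]_n :=
  \matrix_(i, j)
    limn (fun N : nat => (\sum_(0 <= l < N) (l`!%:R)^-1 *: A ^+ l) i j).

Definition Wmx (R : realType) (n : nat) (A : 'M[R]_n) (b : 'cV[R]_n) (T : R) :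
    'M[R]_n :=
  \matrix_(i, j) \int[lebesgue_measure]_(t in `[0, T])
    (expmx (t *: A) *m b *m b^T *m expmx (t *: A^T)) i j.

Definition Phi (R : realType) (n m : nat) (A : 'M[R]_n) (b : 'I_m -> 'cV[R]_n)
    (T : R) (v : 'cV[R]_m) : 'M[R]_n :=
  \sum_(i < m) v i 0 *: Wmx A (b i) T.

Definition simplex (R : realType) (m : nat) : set 'cV[R]_m :=
  [set p | (forall i, 0 <= p i 0) /\ \sum_(i < m) p i 0 = 1].

Definition face (R : realType) (m : nat) (S : {set 'I_m}) : set 'cV[R]_m :=
  [set p | simplex p /\ forall i, i \notin S -> p i 0 = 0].

Definition face_directions (R : realType) (m : nat) (S : {set 'I_m}) :
    set 'cV[R]_m :=
  lin (difference_set (face S)).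

Definition Emx (R : realType) (m k : nat) (s : 'I_k -> 'I_m) : 'M[R]_(m, k) :=
  \matrix_(i, j) (delta_mx (s j) 0 : 'cV[R]_m) i 0.

Definition Mmx (R : realType) (n m k : nat) (A : 'M[R]_n)
    (b : 'I_m -> 'cV[R]_n) (T : R) (s : 'I_k -> 'I_m) : 'M[R]_(n * n, k) :=
  \matrix_(i, j) vec (Wmx A (b (s j)) T) i 0.

(* Main.v *)
From mathcomp Require Import ring lra.
Require Import Defs.

Set Implicit Arguments.
Unset Strict Implicit.
Unset Printing Implicit Defensive.

Import Order.TTheory GRing.Theory Num.Theory.
Import numFieldNormedType.Exports.
Local Open Scope classical_set_scope.
Local Open Scope ring_scope.

(** Everything reduces to two facts.

    The first is the variational description of extreme eigenvalues, which
    makes [lambda_min], [lambda_max] and [sigma_min], defined through sets of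
    eigenvalues, usable in estimates.  For a symmetric X of positive size the
    quadratic form v |-> v^T X v attains its minimum mu on the compact unit
    sphere at some u ([sphere_compact]).  Then X - mu I is positive
    semidefinite and its form vanishes at u, which forces (X - mu I) u = 0
    ([psd_kernel]), so mu is an eigenvalue, and the least one.  Applied to
    X^T X this says that [sigma_min X] is the minimum of |X y| over unit
    vectors y ([sigma_min_variational]), and applied to -X it says that
    [lambda_max X] is the maximum of the quadratic form.  A pointwise maximum
    of functions linear in X is convex in X, hence [lambda_max_convex].

    The second is a pair of isometries.  Stacking the columns of a matrix turns
    the Frobenius norm into the Euclidean norm, so that the Frobenius norm of
    Phi (E z) is |M z| ([normF_Phi]); and y |-> E Z y is an isometry onto the
    span of the differences of points of the face, because that span consists
    of the vectors supported on S with zero sum ([face_directionsE]).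

    In these coordinates the first three claims are statements about the
    matrix M Z alone: the norm identity, the equivalence between injectivity,
    full column rank and positivity of the least singular value, and the
    variational formula for it.  For the last claim, Phi p is a convex
    combination of the symmetric matrices W_i with i in S ([Wmx_sym]), so
    convexity of the largest eigenvalue bounds it by the largest value at the
    vertices e_i with i in S, and these vertices belong to the face. *)

(** * Euclidean norm and quadratic forms *)

Lemma sqr_norm2 (R : realType) d (x : 'cV[R]_d) :
  norm2 x ^+ 2 = (x^T *m x) 0 0.
Proof.
rewrite /norm2 sqr_sqrtr; last by apply: sumr_ge0 => i _; exact: sqr_ge0.
by rewrite mxE; apply: eq_bigr => i _; rewrite mxE expr2.
Qed.

Lemma norm2_ge0 (R : realType) d (x : 'cV[R]_d) : 0 <= norm2 x.
Proof. exact: sqrtr_ge0. Qed.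

Lemma norm2_eq0 (R : realType) d (x : 'cV[R]_d) : (norm2 x == 0) = (x == 0).
Proof.
apply/idP/eqP => [|->]; last first.
  by rewrite /norm2 big1 ?sqrtr0// => i _; rewrite mxE expr0n.
rewrite /norm2 sqrtr_eq0 => x_le0; apply/colP => i; rewrite mxE.
have /eqP : \sum_(i < d) x i 0 ^+ 2 = 0.
  by apply/le_anti; rewrite x_le0 sumr_ge0// => j _; exact: sqr_ge0.
rewrite psumr_eq0; last by move=> j _; exact: sqr_ge0.
by move=> /allP/(_ i (mem_index_enum i)); rewrite /= sqrf_eq0 => /eqP.
Qed.

Lemma norm2_0 (R : realType) d : norm2 (0 : 'cV[R]_d) = 0.
Proof. by apply/eqP; rewrite norm2_eq0. Qed.

Lemma norm2_gt0 (R : realType) d (x : 'cV[R]_d) : (0 < norm2 x) = (x != 0).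
Proof. by rewrite lt_def norm2_ge0 andbT norm2_eq0. Qed.

Lemma quadratic_form_continuous (R : realType) d (X : 'M[R]_d) :
  continuous (fun v : 'rV[R]_d => (v *m X *m v^T) 0 0).
Proof.
have continuous_bigsum (F : 'I_d -> 'rV[R]_d -> R) :
    (forall i, continuous (F i)) -> continuous (fun v => \sum_(i < d) F i v).
  move=> cF; elim: (index_enum _) => [|i r IHr] v.
    rewrite (_ : (fun _ => _) = cst 0); first exact: cst_continuous.
    by apply/funext => w; rewrite big_nil.
  rewrite (_ : (fun _ => _) = F i + (fun w => \sum_(i <- r) F i w)).
    by apply: continuousD; [exact: cF | exact: IHr].
  by apply/funext => w; rewrite big_cons.
have -> : (fun v : 'rV[R]_d => (v *m X *m v^T) 0 0) =
    (fun v => \sum_(j < d) \sum_(i < d) v 0 i * X i j * v 0 j).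
  apply/funext => v; rewrite mxE; apply: eq_bigr => j _.
  by rewrite !mxE mulr_suml.
apply: (continuous_bigsum) => j; apply: (continuous_bigsum) => i v.
apply: (@continuousM _ _ (fun v : 'rV[R]_d => v 0 i * X i j)).
  apply: (@continuousM _ _ (fun v : 'rV[R]_d => v 0 i)).
    exact: coord_continuous.
  exact: cst_continuous.
exact: coord_continuous.
Qed.

Lemma sphere_compact (R : realType) d :
  compact [set v : 'rV[R]_d | (v *m v^T) 0 0 = 1].
Proof.
(* The topology on matrices is that of the sup norm, so a Euclidean sphere is
   placed in a product of segments. *)
have box_compact : compact
    [set v : 'rV[R]_d | forall i, v ord0 i \in `[-1, 1]].
  apply: (@rV_compact _ _ (fun=> `[-1 : R, 1]%classic)).
  by move=> _; exact: segment_compact.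
apply: (subclosed_compact _ box_compact).
  have -> : [set v : 'rV[R]_d | (v *m v^T) 0 0 = 1] =
      (fun v : 'rV[R]_d => (v *m 1%:M *m v^T) 0 0) @^-1` [set 1].
    by apply/seteqP; split => v /=; rewrite mulmx1.
  apply: preimage_closed; last exact: closed_eq.
  by move=> v _; exact: quadratic_form_continuous.
move=> v /= v1 i; rewrite in_itv/= -ler_norml -(@ler_pXn2r _ 2) ?nnegrE//.
rewrite expr1n real_normK ?num_real// -v1 mxE (bigD1 i)//= mxE -expr2 lerDl.
by apply: sumr_ge0 => j _; rewrite mxE -expr2 sqr_ge0.
Qed.

(** Writing w = B x, the form at x - t w is -2 t |w|^2 + t^2 w^T B w, which is
    negative for small t > 0 unless w = 0. *)
Lemma psd_kernel (R : realType) d (B : 'M[R]_d) (x : 'cV[R]_d) :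
  B^T = B -> (forall v : 'cV[R]_d, 0 <= (v^T *m B *m v) 0 0) ->
  (x^T *m B *m x) 0 0 = 0 -> B *m x = 0.
Proof.
move=> symB B_ge0 xBx0; apply/eqP; rewrite -norm2_eq0 -sqrf_eq0.
set w := B *m x; set N := norm2 w ^+ 2; set c := (w^T *m B *m w) 0 0.
have c_ge0 : 0 <= c by exact: B_ge0.
have N_ge0 : 0 <= N by exact: sqr_ge0.
have wBx : (w^T *m B *m x) 0 0 = N by rewrite /N sqr_norm2 -mulmxA.
have xBw : (x^T *m B *m w) 0 0 = N.
  by rewrite /N sqr_norm2 /w trmx_mul symB.
(* This is t = N / (c + 1), with the denominator cleared: nonnegativity of the
   form becomes - N^2 (c + 2) >= 0. *)
have := B_ge0 ((c + 1) *: x - N *: w).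
have -> : (((c + 1) *: x - N *: w)^T *m B *m ((c + 1) *: x - N *: w)) 0 0
    = (c + 1) ^+ 2 * (x^T *m B *m x) 0 0 - (c + 1) * N * (x^T *m B *m w) 0 0
      - (c + 1) * N * (w^T *m B *m x) 0 0 + N ^+ 2 * c.
  have -> : ((c + 1) *: x - N *: w)^T = (c + 1) *: x^T - N *: w^T.
    by rewrite linearB/= !linearZ.
  rewrite !mulmxBl !mulmxBr -!scalemxAl -!scalemxAr /c.
  move: (x^T *m B *m x) (x^T *m B *m w) (w^T *m B *m x) (w^T *m B *m w).
  by move=> P Q U V; rewrite !mxE; ring.
rewrite xBx0 wBx xBw => H; apply/eqP; nra.
Qed.

(** * Extreme eigenvalues of symmetric matrices *)

(** Minimize the quadratic form over the unit sphere: the minimizer is an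
    eigenvector because X minus the minimum is positive semidefinite and its
    form vanishes there. *)
Lemma rayleigh_minimizer (R : realType) d (X : 'M[R]_d) :
  (0 < d)%N -> X^T = X ->
  exists mu (u : 'cV[R]_d), [/\ norm2 u = 1, X *m u = mu *: u
    & forall v : 'cV[R]_d, mu * norm2 v ^+ 2 <= (v^T *m X *m v) 0 0].
Proof.
case: d X => // d X _ symX.
pose q (v : 'rV[R]_d.+1) : R := (v *m X *m v^T) 0 0.
have [|u u1 umin] := compact_EVT_min _ (@sphere_compact R d.+1)
    (continuous_subspaceT (@quadratic_form_continuous R d.+1 X)).
  exists (delta_mx 0 0) => /=.
  by rewrite trmx_delta mul_delta_mx mxE !eqxx.
move: u1; rewrite inE/= => u1.
have u1' : norm2 u^T = 1.
  by apply/eqP; rewrite -(@eqrXn2 _ 2) ?norm2_ge0// sqr_norm2 trmxK u1 expr1n.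
have qmin (v : 'cV[R]_d.+1) : q u * norm2 v ^+ 2 <= (v^T *m X *m v) 0 0.
  have [->|v0] := eqVneq v 0.
    by rewrite mulmx0 mxE norm2_0 expr0n mulr0.
  have nv : 0 < norm2 v by rewrite norm2_gt0.
  have := umin ((norm2 v)^-1 *: v^T).
  rewrite inE/= linearZ/= trmxK -!scalemxAl -!scalemxAr !scalerA -invfM -expr2.
  have scaleE (a : R) (P : 'M[R]_1) : (a *: P) 0 0 = a * P 0 0 by rewrite mxE.
  rewrite !scaleE -sqr_norm2 mulVf ?expf_neq0 ?gt_eqF//.
  by move=> /(_ erefl); rewrite mulrC ler_pdivlMr ?exprn_gt0.
exists (q u), u^T; split => //.
apply/eqP; rewrite -subr_eq0 -mul_scalar_mx -mulmxBl; apply/eqP.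
have qB (v : 'cV[R]_d.+1) : (v^T *m (X - (q u)%:M) *m v) 0 0 =
    (v^T *m X *m v) 0 0 - q u * norm2 v ^+ 2.
  by rewrite mulmxBr mulmxBl mul_mx_scalar -scalemxAl !mxE sqr_norm2 mxE.
apply: psd_kernel.
- by rewrite linearB/= tr_scalar_mx symX.
- by move=> v; rewrite qB subr_ge0.
- by rewrite qB u1' expr1n mulr1 trmxK subrr.
Qed.

(** The minimum mu of the quadratic form is an eigenvalue, and evaluating the
    form at an eigenvector of any eigenvalue a gives mu <= a. *)
Lemma lambda_min_rayleigh (R : realType) d (X : 'M[R]_d) :
  (0 < d)%N -> X^T = X ->
  (exists2 u : 'cV[R]_d, norm2 u = 1 & X *m u = lambda_min X *: u) /\
  forall v : 'cV[R]_d, lambda_min X * norm2 v ^+ 2 <= (v^T *m X *m v) 0 0.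
Proof.
move=> d_gt0 symX.
have [mu [u [u1 Xu mu_min]]] := rayleigh_minimizer d_gt0 symX.
have mu_eigen : eigenvalue X mu.
  apply/eigenvalueP; exists u^T.
    by rewrite -[in LHS]symX -trmx_mul Xu linearZ.
  by rewrite trmx_eq0 -norm2_eq0 u1 oner_eq0.
have mu_lb : lbound [set a | eigenvalue X a] mu.
  move=> a /= /eigenvalueP[v vX v0].
  have := mu_min v^T; rewrite trmxK vX -scalemxAl mxE.
  have {1}-> : (v *m v^T) 0 0 = norm2 v^T ^+ 2 by rewrite sqr_norm2 trmxK.
  by rewrite ler_pM2r// exprn_gt0// norm2_gt0 trmx_eq0.
suff -> : lambda_min X = mu by split=> //; exists u.
apply/le_anti; rewrite /lambda_min lb_le_inf//; last by exists mu.
by rewrite ge_inf//; exists mu.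
Qed.

Lemma lambda_maxE (R : realType) d (X : 'M[R]_d) :
  lambda_max X = - lambda_min (- X).
Proof.
rewrite /lambda_max /lambda_min /inf opprK; congr (sup _).
have eigenN (Y : 'M[R]_d) a : eigenvalue Y a -> eigenvalue (- Y) (- a).
  move=> /eigenvalueP[v vY v0]; apply/eigenvalueP; exists v => //.
  by rewrite mulmxN vY scaleNr.
apply/seteqP; split => a /=.
  by move=> /eigenN ?; exists (- a); rewrite ?opprK.
by case=> c /eigenN + <-; rewrite opprK.
Qed.

Lemma lambda_max_rayleigh (R : realType) d (X : 'M[R]_d) :
  (0 < d)%N -> X^T = X ->
  (exists2 u : 'cV[R]_d, norm2 u = 1 & (u^T *m X *m u) 0 0 = lambda_max X) /\
  forall v : 'cV[R]_d, (v^T *m X *m v) 0 0 <= lambda_max X * norm2 v ^+ 2.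
Proof.
move=> d_gt0 symX; have symNX : (- X)^T = - X by rewrite linearN/= symX.
have [[u u1 Xu] X_ge] := lambda_min_rayleigh d_gt0 symNX.
rewrite lambda_maxE; split => [|v].
  exists u => //; rewrite -mulmxA -[X *m u]opprK -mulNmx Xu mulmxN -scalemxAr.
  by rewrite mxE [X in - X]mxE -sqr_norm2 u1 expr1n mulr1.
have := X_ge v; rewrite mulmxN mulNmx mxE; lra.
Qed.

(** By the Rayleigh principle the left side is the value of the combined form
    at a unit vector u, and each form is at most its largest eigenvalue at u.
    The bound is only asked where p does not vanish, since on a face the
    weights outside S are zero. *)
Lemma lambda_max_convex (R : realType) d (I : finType) (p : I -> R)
    (X : I -> 'M[R]_d) (c : R) :
  (forall i, 0 <= p i) -> \sum_i p i = 1 -> (forall i, (X i)^T = X i) ->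
  (forall i, p i != 0 -> lambda_max (X i) <= c) ->
  lambda_max (\sum_i p i *: X i) <= c.
Proof.
move=> p_ge0 p1 symX X_le.
have [d0|d_gt0] := posnP d.
  (* A matrix of size 0 has no eigenvalue, so that the Rayleigh principle fails;
     but there is only one such matrix, and some weight is nonzero. *)
  have [i pi0] : exists i, p i != 0.
    apply: contrapT => /forallNP p0; move: p1; rewrite big1 => [/esym/eqP|i _].
      by rewrite oner_eq0.
    by apply/eqP/negPn/negP/p0.
  rewrite (_ : \sum_i _ = X i); first exact: X_le.
  by apply/matrixP => j; exfalso; move: j; rewrite d0 => -[].
have symS : (\sum_i p i *: X i)^T = \sum_i p i *: X i.
  by rewrite linear_sum; apply: eq_bigr => i _; rewrite linearZ/= symX.
have [[u u1 <-] _] := lambda_max_rayleigh d_gt0 symS.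
rewrite mulmx_sumr mulmx_suml summxE -[c]mul1r -p1 mulr_suml.
apply: ler_sum => i _; rewrite -scalemxAr -scalemxAl mxE.
have [->|pi0] := eqVneq (p i) 0; first by rewrite !mul0r.
apply: ler_wpM2l => //; apply: le_trans (X_le i pi0).
have [_ /(_ u)] := lambda_max_rayleigh d_gt0 (symX i).
by rewrite u1 expr1n mulr1.
Qed.

(** * Least singular value *)

(** The quadratic form of X^T X is v |-> |X v|^2. *)
Lemma sigma_min_variational (R : realType) a c (X : 'M[R]_(a, c)) :
  (0 < c)%N ->
  (exists2 u : 'cV[R]_c, norm2 u = 1 & norm2 (X *m u) = sigma_min X) /\
  forall v : 'cV[R]_c, sigma_min X * norm2 v <= norm2 (X *m v).
Proof.
move=> c_gt0.
have symXX : (X^T *m X)^T = X^T *m X by rewrite trmx_mul trmxK.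
have gramE (v : 'cV[R]_c) :
    (v^T *m (X^T *m X) *m v) 0 0 = norm2 (X *m v) ^+ 2.
  by rewrite sqr_norm2 trmx_mul !mulmxA.
have [[u u1 Xu] X_ge] := lambda_min_rayleigh c_gt0 symXX.
have sqXu : norm2 (X *m u) ^+ 2 = lambda_min (X^T *m X).
  by rewrite -gramE -mulmxA Xu -scalemxAr mxE -sqr_norm2 u1 expr1n mulr1.
split=> [|v].
  by exists u => //; rewrite /sigma_min -sqXu sqrtr_sqr ger0_norm ?norm2_ge0.
rewrite -(@ler_pXn2r _ 2) ?nnegrE ?mulr_ge0 ?sqrtr_ge0//.
rewrite exprMn -gramE sqr_sqrtr; first exact: X_ge.
by rewrite -sqXu sqr_ge0.
Qed.

(** [row_free] speaks of left multiplication on row vectors, whence the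
    transpositions. *)
Lemma mxrank_injective (R : realType) a c (X : 'M[R]_(a, c)) :
  \rank X = c <-> forall y : 'cV[R]_c, X *m y = 0 -> y = 0.
Proof.
rewrite -mxrank_tr; split=> [Xc y Xy0|X_inj].
  have /row_free_inj Xinj : row_free X^T by rewrite /row_free Xc.
  apply: trmx_inj; rewrite trmx0; apply: (Xinj 1%N).
  by rewrite -trmx_mul Xy0 trmx0 mul0mx.
apply/eqP; rewrite -[_ == _]/(row_free X^T) -kermx_eq0; apply/rowV0P => y.
move=> /sub_kermxP yX; apply: trmx_inj; rewrite trmx0; apply: X_inj.
by apply: trmx_inj; rewrite trmx_mul trmxK yX trmx0.
Qed.

Lemma sigma_min_gt0 (R : realType) a c (X : 'M[R]_(a, c)) :
  (0 < c)%N -> \rank X = c <-> 0 < sigma_min X.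
Proof.
move=> c_gt0; have [[u u1 Xu] X_ge] := sigma_min_variational X c_gt0.
rewrite mxrank_injective; split=> [X_inj|s_gt0 y Xy0].
  rewrite -Xu norm2_gt0.
  apply/eqP => /X_inj u0; move/eqP: u1.
  by rewrite u0 norm2_0 eq_sym oner_eq0.
apply/eqP; rewrite -norm2_eq0; apply/eqP/le_anti; rewrite norm2_ge0 andbT.
by have := X_ge y; rewrite Xy0 norm2_0 pmulr_rle0.
Qed.

(** * The map Phi and vectorization *)

Lemma norm2_vec (R : realType) a c (X : 'M[R]_(a, c)) : norm2 (vec X) = normF X.
Proof.
rewrite /norm2 /normF; congr Num.sqrt.
rewrite exchange_big/= pair_big/=.
rewrite (reindex _ (curry_mxvec_bij _ _)).
by apply: eq_bigr => -[i j] _ /=; rewrite /vec mxE mxvecE mxE.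
Qed.

Lemma Phi_vertices (R : realType) n m k (A : 'M[R]_n) (b : 'I_m -> 'cV[R]_n)
    (T : R) (s : 'I_k -> 'I_m) (z : 'cV[R]_k) :
  Phi A b T (Emx R s *m z) = \sum_j z j 0 *: Wmx A (b (s j)) T.
Proof.
rewrite /Phi.
under eq_bigr => i _ do rewrite mxE scaler_suml.
rewrite exchange_big/=; apply: eq_bigr => j _.
rewrite (bigD1 (s j))//= big1 => [|i /negPf ij].
  by rewrite !mxE !eqxx mul1r addr0.
by rewrite !mxE ij mul0r scale0r.
Qed.

Lemma normF_Phi (R : realType) n m k (A : 'M[R]_n) (b : 'I_m -> 'cV[R]_n)
    (T : R) (s : 'I_k -> 'I_m) (z : 'cV[R]_k) :
  normF (Phi A b T (Emx R s *m z)) = norm2 (Mmx A b T s *m z).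
Proof.
rewrite -norm2_vec; congr norm2; apply/colP => i.
have vecE (X : 'M[R]_n) p q : vec X (mxvec_index p q) 0 = X q p.
  by rewrite mxE mxvecE mxE.
case/mxvec_indexP: i => p q; rewrite Phi_vertices vecE summxE mxE.
by apply: eq_bigr => j _; rewrite [Mmx _ _ _ _ _ _]mxE vecE mxE mulrC.
Qed.

Lemma Phi_delta (R : realType) n m (A : 'M[R]_n) (b : 'I_m -> 'cV[R]_n)
    (T : R) i : Phi A b T (delta_mx i 0) = Wmx A (b i) T.
Proof.
rewrite /Phi (bigD1 i)//= big1 => [|j /negPf ji].
  by rewrite mxE !eqxx scale1r addr0.
by rewrite mxE ji scale0r.
Qed.

Lemma PhiB (R : realType) n m (A : 'M[R]_n) (b : 'I_m -> 'cV[R]_n)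
    (T : R) : {morph Phi A b T : u v / u - v}.
Proof.
move=> u v; rewrite /Phi -sumrB; apply: eq_bigr => i _.
by rewrite !mxE scalerBl.
Qed.

Lemma normF_eq0 (R : realType) a c (X : 'M[R]_(a, c)) :
  (normF X == 0) = (X == 0).
Proof. by rewrite -norm2_vec norm2_eq0 trmx_eq0 mxvec_eq0 trmx_eq0. Qed.

(** * Directions of the face *)

Lemma delta_face (R : realType) m (S : {set 'I_m}) i :
  i \in S -> @face R m S (delta_mx i 0).
Proof.
move=> iS; split=> [|j jS]; last first.
  by rewrite mxE; case: eqP => // ji; rewrite ji iS in jS.
split=> [j|]; first by rewrite mxE ler0n.
rewrite (bigD1 i)//= big1 => [|j /negPf ji]; rewrite mxE ?ji//.
by rewrite !eqxx addr0.
Qed.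

(** Points of the face vanish outside S and have coordinates of sum 1, so
    combinations of their differences vanish outside S and have sum 0.
    Conversely, when the z_j sum to 0, the vector E z = sum_j z_j e_(s j) equals
    sum_j z_j (e_(s j) - e_(s j0)) for any fixed j0, a combination of
    differences of vertices. *)
Lemma face_directionsE (R : realType) m k (s : 'I_k -> 'I_m) :
  (0 < k)%N -> injective s ->
  @face_directions R m [set s j | j in 'I_k]%SET =
  [set Emx R s *m z | z in
    [set z : 'cV[R]_k | (const_mx 1 : 'cV[R]_k)^T *m z = 0]].
Proof.
move=> k_gt0 s_inj.
have sumE (z : 'cV[R]_k) :
    ((const_mx 1 : 'cV[R]_k)^T *m z) 0 0 = \sum_j z j 0.
  by rewrite mxE; apply: eq_bigr => j _; rewrite !mxE mul1r.
apply/seteqP; split => [v [N [a [u [uS ->]]]] | _ [z z0 <-]].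
  set w := \sum_(j < N) _.
  have w_out i : i \notin [set s j | j in 'I_k]%SET -> w i 0 = 0.
    move=> iS; rewrite /w summxE big1// => j _.
    have [p [q [[_ pS] [_ qS] ->]]] := uS j.
    by rewrite !mxE pS// qS// subrr mulr0.
  have w_sum : \sum_i w i 0 = 0.
    under eq_bigr => i _ do rewrite /w summxE.
    rewrite exchange_big/= big1// => j _.
    have [p [q [[[_ p1] _] [[_ q1] _] ->]]] := uS j.
    under eq_bigr => i _ do rewrite !mxE.
    by rewrite -mulr_sumr sumrB p1 q1 subrr mulr0.
  have wE : Emx R s *m \col_j w (s j) 0 = w.
    apply/colP => i; rewrite mxE.
    have [/imsetP[j _ ->]|iS] := boolP (i \in [set s j | j in 'I_k]%SET).
      rewrite (bigD1 j)//= big1 => [|l /negPf lj].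
        by rewrite !mxE !eqxx mul1r addr0.
      by rewrite !mxE (inj_eq s_inj) eq_sym lj mul0r.
    rewrite w_out// big1// => j _; rewrite !mxE.
    case: eqP => [ij|_]; last by rewrite mul0r.
    by case/negP: iS; rewrite ij imset_f.
  exists (\col_j w (s j) 0) => //=; apply/matrixP => i j.
  rewrite !ord1 sumE mxE.
  have := w_sum; rewrite (bigID (mem [set s j | j in 'I_k]%SET))/=.
  rewrite [X in _ + X]big1; last exact: w_out.
  rewrite addr0 big_imset/=; last by move=> ? ? _ _; exact: s_inj.
  by under [in X in _ -> X]eq_bigr => l _ do rewrite mxE.
pose j0 := Ordinal k_gt0.
exists k, (fun j => z j 0), (fun j => delta_mx (s j) 0 - delta_mx (s j0) 0).
split=> [j|].
  exists (delta_mx (s j) 0), (delta_mx (s j0) 0); split => //;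
    by apply: delta_face; rewrite imset_f.
under eq_bigr => j _ do rewrite scalerBr.
rewrite sumrB -scaler_suml -sumE z0 mxE scale0r subr0.
apply/colP => i; rewrite mxE summxE.
by apply: eq_bigr => j _; rewrite !mxE mulrC.
Qed.

Lemma Emx_isometry (R : realType) m k (s : 'I_k -> 'I_m) :
  injective s -> (Emx R s)^T *m Emx R s = 1%:M.
Proof.
move=> s_inj; apply/matrixP => i j; rewrite !mxE (bigD1 (s i))//= big1.
  by rewrite !mxE !eqxx mul1r addr0 andbT (inj_eq s_inj).
by move=> l /negPf li; rewrite !mxE li mul0r.
Qed.

Lemma norm2_isometry (R : realType) a c (Q : 'M[R]_(a, c)) (y : 'cV[R]_c) :
  Q^T *m Q = 1%:M -> norm2 (Q *m y) = norm2 y.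
Proof.
move=> QQ; apply/eqP; rewrite -(@eqrXn2 _ 2) ?norm2_ge0//.
by rewrite !sqr_norm2 trmx_mul mulmxA -(mulmxA y^T) QQ mulmx1.
Qed.

(** * Symmetry of the Gramians *)

Lemma expmx_tr (R : realType) n (A : 'M[R]_n) : expmx A^T = (expmx A)^T.
Proof.
apply/matrixP => i j; rewrite !mxE; congr (limn _); apply/funext => N.
rewrite !summxE; apply: eq_bigr => l _; rewrite !mxE; congr (_ * _).
suff -> : A^T ^+ l = (A ^+ l)^T by rewrite mxE.
by elim: l => [|l IHl]; rewrite ?expr0 ?trmx1// exprS IHl exprSr trmx_mul.
Qed.

(** Since exp(t A^T) is the transpose of exp(t A), the integrand is a symmetric
    matrix at each t, and integrals are taken entrywise. *)
Lemma Wmx_sym (R : realType) n (A : 'M[R]_n) (b : 'cV[R]_n) (T : R) :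
  (Wmx A b T)^T = Wmx A b T.
Proof.
apply/matrixP => i j; rewrite !mxE; apply: eq_Rintegral => t _.
have -> : t *: A^T = (t *: A)^T by rewrite linearZ.
rewrite expmx_tr; set G := _ *m _.
have {1}<- : G^T = G by rewrite /G !trmx_mul !trmxK !mulmxA.
by rewrite mxE.
Qed.

Theorem proposition1 (R : realType) (n m k : nat) (A : 'M[R]_n)
    (b : 'I_m -> 'cV[R]_n) (T : R) (T_gt0 : 0 < T)
    (S : {set 'I_m}) (k_ge2 : (2 <= k)%N)
    (s : 'I_k -> 'I_m) (s_inj : injective s)
    (S_def : S = [set s j | j in 'I_k]%SET)
    (Z : 'M[R]_(k, k.-1))
    (Z_basis : orthonormal_basis_columns Z
       [set z : 'cV[R]_k | (const_mx 1 : 'cV[R]_k)^T *m z = 0]) :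
  [/\ forall y : 'cV[R]_(k.-1),
        normF (Phi A b T (Emx R s *m Z *m y)) = norm2 (Mmx A b T s *m Z *m y),
      (set_inj (@face_directions R m S) (Phi A b T)
         <-> \rank (Mmx A b T s *m Z) = k.-1) /\
      (\rank (Mmx A b T s *m Z) = k.-1 <-> 0 < sigma_min (Mmx A b T s *m Z)),
      is_minimum
        [set normF (Phi A b T v)
           | v in [set v | @face_directions R m S v /\ norm2 v = 1]]
        (sigma_min (Mmx A b T s *m Z))
    & exists beta : R,
        is_maximum [set lambda_max (Phi A b T p) | p in @face R m S] beta /\
        is_maximum [set lambda_max (Wmx A (b i) T) | i in [set i | i \in S]]
          beta].
Proof.
have k_gt0 : (0 < k)%N by exact: ltnW.
have k1_gt0 : (0 < k.-1)%N by rewrite -subn1 subn_gt0.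
case: Z_basis => ZZ Z_range.
set X := Mmx A b T s *m Z.
have normF_dir y : normF (Phi A b T (Emx R s *m Z *m y)) = norm2 (X *m y).
  by rewrite -mulmxA normF_Phi mulmxA.
have norm2_dir y : norm2 (Emx R s *m Z *m y) = norm2 y.
  by rewrite -mulmxA !norm2_isometry// Emx_isometry.
have dirE : @face_directions R m S = [set Emx R s *m Z *m y | y in setT].
  rewrite S_def face_directionsE// -Z_range image_comp.
  by apply: eq_imagel => y _ /=; rewrite mulmxA.
have Phi0 : Phi A b T 0 = 0 by rewrite -[0 in LHS](subrr 0) PhiB subrr.
split => //.
- split; last exact: sigma_min_gt0.
  rewrite mxrank_injective dirE; split=> [Phi_inj y Xy0|X_inj v w].
    have : Emx R s *m Z *m y = 0.
      apply: Phi_inj; rewrite ?inE.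
      - by exists y.
      - by exists (0 : 'cV_(k.-1)); rewrite ?mulmx0.
      by rewrite Phi0; apply/eqP; rewrite -normF_eq0 normF_dir Xy0 norm2_0.
    by move/eqP; rewrite -norm2_eq0 norm2_dir norm2_eq0 => /eqP.
  rewrite !inE => -[y _ <-] [z _ <-] /eqP; rewrite -subr_eq0 -PhiB -mulmxBr.
  rewrite -normF_eq0 normF_dir norm2_eq0 => /eqP/X_inj/eqP.
  by rewrite subr_eq0 => /eqP ->.
- have [[u u1 Xu] X_ge] := sigma_min_variational X k1_gt0.
  rewrite dirE; split.
    exists (Emx R s *m Z *m u); last by rewrite normF_dir.
    by split; [exists u | rewrite norm2_dir].
  move=> _ [_ [[y _ <-] y1] <-]; rewrite norm2_dir in y1.
  by rewrite normF_dir -[leLHS]mulr1 -y1; exact: X_ge.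
- pose L i := lambda_max (Wmx A (b i) T).
  have s0S : s (Ordinal k_gt0) \in S by rewrite S_def imset_f.
  have [i iS i_max] := Order.TotalTheory.arg_maxP L s0S.
  exists (L i); split; split.
  + exists (delta_mx i 0); first exact: delta_face.
    by rewrite Phi_delta.
  + move=> _ [p [[p_ge0 p1] pS] <-].
    apply: (lambda_max_convex p_ge0 p1 (fun j => Wmx_sym A (b j) T)) => j pj.
    by apply: i_max; apply: contraNT pj => /pS ->; rewrite eqxx.
  + by exists i.
  + by move=> _ [j jS <-]; exact: i_max.
Qed.
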